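(* Let $\mathcal{H},\mathcal{K}$ be Hilbert spaces, let $V\in\mathcal{B}(\mathcal{H})$ be a pure isometry (a unilateral shift), let $T\in\mathcal{B}(\mathcal{K})$ be a right invertible contraction, and for $Y\in\mathcal{B}(\mathcal{H},\mathcal{K})$ write $$R(Y)=\begin{bmatrix}T & Y\\ 0 & V\end{bmatrix}\in\mathcal{B}(\mathcal{K}\oplus\mathcal{H}),$$ so $R(0)=T\oplus V$. Let $X\in\mathcal{B}(\mathcal{H},\mathcal{K})$. Then $R(X)$ is similar to a contraction if and only if there exist $A\in\mathcal{B}(\mathcal{H},\mathcal{K})$ and a nilpotent $E\in\mathcal{B}(\mathcal{K}\oplus\mathcal{H})$ with $ER(A)=0$ and $R(X)=R(A)+E$, such that $R(A)$ is quadratically near $R(0)$ modulo $\ker V^*$, i.e. there is a constant $s$ with $$\Big\|\sum_{n=0}^{N}\big(R(A)^n-R(0)^n\big)x_n\Big\|\le s\Big(\sum_{n=0}^N\|x_n\|^2\Big)^{1/2}$$ for every $N\in\mathbb{N}$ and all $x_0,\ldots,x_N\in\{0\}\oplus\ker V^*\subset\mathcal{K}\oplus\mathcal{H}$.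
   Context: An operator is similar to a contraction if it is conjugate by an invertible operator to an operator of norm at most 1. *)

(* Defs.v *)
From HB Require Import structures.
From mathcomp Require Import all_boot all_order all_algebra.
From mathcomp Require Import all_classical all_reals.
From mathcomp Require Import topology normedtype.
From mathcomp.real_closed Require Import complex.
Set Implicit Arguments. Unset Strict Implicit. Unset Printing Implicit Defensive.
Import Order.TTheory GRing.Theory Num.Theory.
Local Open Scope ring_scope.
Local Open Scope complex_scope.

Section Defs.
Variable R : realType.
Local Notation C := R[i].

(* An inner product on a complex normed space inducing its norm:
   linear in the first argument, conjugate symmetric, <x,x> = ||x||^2.
   A Hilbert space is a complete normed C-module equipped with such an
   inner product. *)
Record inner_product (H : normedModType C) := InnerProduct {
  ip : H -> H -> C;
  ip_linear : forall (a : C) (x y z : H), ip (a *: x + y) z = a * ip x z + ip y z;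
  ip_conj : forall x y : H, ip y x = (ip x y)^*;
  ip_norm : forall x : H, ip x x = `|x| ^+ 2
}.

Definition bounded_op (U W : normedModType C) (f : U -> W) : Prop :=
  (forall (a : C) (x y : U), f (a *: x + y) = a *: f x + f y) /\
  exists c : C, forall x : U, `|f x| <= c * `|x|.

Definition sqnorm2 (K H : normedModType C) (z : K * H) : C :=
  `|z.1| ^+ 2 + `|z.2| ^+ 2.

Definition add2 (K H : normedModType C) (z w : K * H) : K * H :=
  (z.1 + w.1, z.2 + w.2).
Definition sub2 (K H : normedModType C) (z w : K * H) : K * H :=
  (z.1 - w.1, z.2 - w.2).

Definition bounded_op2 (K H : normedModType C) (f : K * H -> K * H) : Prop :=
  (forall (a : C) (z w : K * H),
      f (a *: z.1 + w.1, a *: z.2 + w.2) = add2 (a *: (f z).1, a *: (f z).2) (f w)) /\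
  exists c : C, forall z : K * H, sqnorm2 (f z) <= c * sqnorm2 z.

Definition Rop (K H : normedModType C) (T : K -> K) (V : H -> H) (Y : H -> K)
  : K * H -> K * H := fun z => (T z.1 + Y z.2, V z.2).

Definition contraction2 (K H : normedModType C) (f : K * H -> K * H) : Prop :=
  forall z, sqnorm2 (f z) <= sqnorm2 z.

Definition similar_to_contraction (K H : normedModType C)
  (f : K * H -> K * H) : Prop :=
  exists S S' : K * H -> K * H,
    [/\ bounded_op2 S, bounded_op2 S',
        (forall z, S (S' z) = z), (forall z, S' (S z) = z)
      & contraction2 (fun z => S' (f (S z)))].

Definition nilpotent2 (K H : normedModType C) (E : K * H -> K * H) : Prop :=
  exists n : nat, forall z, iter n E z = (0, 0).

(* pure isometry (unilateral shift): isometry with trivial intersection of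
   the ranges of its powers, i.e. no unitary part (Wold decomposition) *)
Definition pure_isometry (H : normedModType C) (V : H -> H) : Prop :=
  [/\ bounded_op V, (forall x, `|V x| = `|x|)
    & forall x, (forall n, exists y, x = iter n V y) -> x = 0].

Definition right_invertible_contraction (K : normedModType C) (T : K -> K) : Prop :=
  [/\ bounded_op T, (forall x, `|T x| <= `|x|)
    & exists T' : K -> K, bounded_op T' /\ forall x, T (T' x) = x].

Definition is_adjoint (H : normedModType C) (ipH : inner_product H) (V W : H -> H) : Prop :=
  forall x y, ip ipH (V x) y = ip ipH x (W y).

Definition quad_near (K H : normedModType C) (RA R0 : K * H -> K * H)
  (M : H -> Prop) : Prop :=
  exists s : C, 0 <= s /\
    forall (N : nat) (x : nat -> H), (forall n, (n <= N)%N -> M (x n)) ->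
      sqnorm2 (\big[@add2 K H/(0, 0)]_(n < N.+1)
                 sub2 (iter n RA (0, x n)) (iter n R0 (0, x n)))
      <= s ^+ 2 * \sum_(n < N.+1) `|x n| ^+ 2.

End Defs.

(* Main.v *)
(* Everything reduces to: R(X) is similar to a contraction iff X = L V - T L
   for a bounded L.

   Suppose R = R(X) is a contraction for an equivalent Hilbert norm p on K + H.
   Shearing by the p-orthogonal projection onto K makes p(k,h) = a(k) + d(h),
   so that a(T k + X h) + d(V h) <= a(k) + d(h). For c large b = c|.|^2 - d is
   an equivalent Hilbert norm on H, and b(V h) = b(h) + d(h) - d(V h). Let W be
   the b-orthogonal projection onto V H followed by the inverse of V. Then
   L = sum_k T^k X W^(k+1) solves L V = T L + X; its partial sums satisfy
   a(L_n h) <= b(h) - b(W^n h), which gives both boundedness and convergence.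

   Quadratic nearness of R(A) says that V^n x |-> (R(A)^n (0,x)).1 for x in
   ker V^* extends to a bounded L, by the Wold decomposition, and this L
   satisfies A = L V - T L and vanishes on ker V^*. Conversely, given
   X = L V - T L, replacing L by L V V^* changes X only on ker V^*, whence A
   and E; a change of X on ker V^* is absorbed in L by a right inverse of T. *)
Require Import Defs.
From HB Require Import structures.
From mathcomp Require Import all_boot all_order all_algebra.
From mathcomp Require Import all_classical all_reals.
From mathcomp Require Import interval_inference topology normedtype sequences.
From mathcomp.real_closed Require Import complex.
From mathcomp Require Import ring lra.
Set Implicit Arguments. Unset Strict Implicit. Unset Printing Implicit Defensive.
Import Order.TTheory GRing.Theory Num.Theory.
Local Open Scope classical_set_scope.
Local Open Scope ring_scope.
Local Open Scope complex_scope.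

(** * Linear maps given as bare functions *)

Section LinearFunctions.
Context {F : nzRingType} {U W : lmodType F} {f : U -> W}.
Hypothesis lf : linear f.

Lemma linB x y : f (x - y) = f x - f y.
Proof. exact: additive_linear. Qed.

Lemma lin0 : f 0 = 0.
Proof. by rewrite -(subrr (0 : U)) linB subrr. Qed.

Lemma linN x : f (- x) = - f x.
Proof. by rewrite -sub0r linB lin0 sub0r. Qed.

Lemma linD x y : f (x + y) = f x + f y.
Proof. by rewrite -[in LHS](opprK y) linB linN opprK. Qed.

Lemma linZ s x : f (s *: x) = s *: f x.
Proof. exact: scalable_linear. Qed.

End LinearFunctions.

Lemma linear_sub (F : nzRingType) (U W : lmodType F) (f g : U -> W) :
  linear f -> linear g -> linear (fun x => f x - g x).
Proof. by move=> lf lg s x y; rewrite lf lg opprD addrACA scalerBr. Qed.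

Lemma linear_comp (F : nzRingType) (U W Y : lmodType F) (f : W -> Y) (g : U -> W) :
  linear f -> linear g -> linear (fun x => f (g x)).
Proof. by move=> lf lg s x y; rewrite lg lf. Qed.

Lemma linear_iter (F : nzRingType) (U : lmodType F) (f : U -> U) n :
  linear f -> linear (iter n f).
Proof. by move=> lf; elim: n => // n IH s x y; rewrite !iterS IH lf. Qed.

(** * Real-valued norms, boundedness and convergence *)

Section RealNorm.
Context {R : realType}.
Local Notation C := R[i].

(** Norms take values in [R[i]], which is only partially ordered; the real part loses nothing and
    allows infima, square roots and [lra]. *)
Definition rnorm {U : normedModType C} (x : U) : R := complex.Re `|x|.
Definition sqn {U : normedModType C} (x : U) : R := rnorm x ^+ 2.

Lemma rnormE (U : normedModType C) (x : U) : `|x| = (rnorm x)%:C.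
Proof. by rewrite /rnorm RRe_real// normr_real. Qed.

Lemma rnorm_ge0 (U : normedModType C) (x : U) : 0 <= rnorm x.
Proof. by rewrite -ler0c -rnormE. Qed.

Lemma rnormD (U : normedModType C) (x y : U) : rnorm (x + y) <= rnorm x + rnorm y.
Proof. by rewrite -lecR rmorphD/= -!rnormE ler_normD. Qed.

Lemma sqnE (U : normedModType C) (x : U) : `|x| ^+ 2 = (sqn x)%:C.
Proof. by rewrite rnormE -rmorphXn. Qed.

Lemma sqn_ge0 (U : normedModType C) (x : U) : 0 <= sqn x.
Proof. exact: sqr_ge0. Qed.

Lemma sqnN (U : normedModType C) (x : U) : sqn (- x) = sqn x.
Proof. by rewrite /sqn /rnorm normrN. Qed.

Lemma sqn0 (U : normedModType C) : sqn (0 : U) = 0.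
Proof. by rewrite /sqn /rnorm normr0 expr0n. Qed.

Lemma sqn_eq0 (U : normedModType C) (x : U) : sqn x <= 0 -> x = 0.
Proof.
move=> x0; apply/eqP; rewrite -normr_eq0 rnormE.
suff -> : rnorm x = 0 by rewrite eqxx.
by apply/eqP; rewrite -sqrf_eq0; apply/eqP/le_anti; rewrite x0 sqn_ge0.
Qed.

Lemma sqnD (U : normedModType C) (x y : U) :
  sqn (x + y) <= 2 * sqn x + 2 * sqn y.
Proof.
have h : sqn (x + y) <= (rnorm x + rnorm y) ^+ 2.
  by rewrite /sqn ler_pXn2r// ?nnegrE ?addr_ge0 ?rnorm_ge0// rnormD.
apply: le_trans h _; rewrite /sqn -subr_ge0.
by rewrite (_ : _ - _ = (rnorm x - rnorm y) ^+ 2) ?sqr_ge0//; ring.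
Qed.

Lemma sqnB (U : normedModType C) (x y : U) :
  sqn (x - y) <= 2 * sqn x + 2 * sqn y.
Proof. by rewrite -(sqnN y) sqnD. Qed.

Lemma rnorm_bound (U W : normedModType C) (x : U) (y : W) (c : R) :
  0 <= c -> (rnorm y <= c * rnorm x) = (sqn y <= c ^+ 2 * sqn x).
Proof.
move=> c0; rewrite /sqn -exprMn ler_pXn2r// nnegrE ?rnorm_ge0//.
by rewrite mulr_ge0 ?rnorm_ge0.
Qed.

(** The complex constant in [bounded_op] is unconstrained when the space is zero; its modulus always
    serves instead. *)
Lemma ge0_le_normM (a b c : C) : 0 <= a -> 0 <= b -> a <= c * b -> a <= `|c| * b.
Proof.
move=> a0 b0 h; rewrite -[X in _ * X](ger0_norm b0) -normrM ger0_norm//.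
exact: le_trans h.
Qed.

Lemma bounded_op_sqnP (U W : normedModType C) (f : U -> W) :
  bounded_op f <-> linear f /\
    exists2 c : R, 0 <= c & forall x, sqn (f x) <= c * sqn x.
Proof.
split=> -[lf [c]].
  move=> fc; split=> //; exists (rnorm (c : C^o) ^+ 2) => [|x]; first exact: sqr_ge0.
  rewrite -rnorm_bound ?rnorm_ge0// -lecR rmorphM/= -!rnormE.
  by apply: ge0_le_normM => //; exact: fc.
move=> c0 fc; split=> //; exists (Num.sqrt c)%:C => x.
rewrite !rnormE -rmorphM lecR rnorm_bound ?sqrtr_ge0//.
by rewrite sqr_sqrtr.
Qed.

Definition sqn2 {K H : normedModType C} (z : K * H) : R := sqn z.1 + sqn z.2.

Lemma sqn2E (K H : normedModType C) (z : K * H) : sqnorm2 z = (sqn2 z)%:C.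
Proof. by rewrite /sqnorm2 !sqnE -rmorphD. Qed.

Lemma sqn2_ge0 (K H : normedModType C) (z : K * H) : 0 <= sqn2 z.
Proof. by rewrite addr_ge0 ?sqn_ge0. Qed.

Lemma bounded_op2_sqnP (K H : normedModType C) (f : K * H -> K * H) :
  bounded_op2 f <-> linear f /\
    exists2 c : R, 0 <= c & forall z, sqn2 (f z) <= c * sqn2 z.
Proof.
split=> -[lf [c]].
  move=> fc; split=> //; exists (rnorm (c : C^o)) => [|z]; first exact: rnorm_ge0.
  rewrite -lecR rmorphM/= -rnormE -!sqn2E.
  by apply: ge0_le_normM (fc z); rewrite sqn2E ler0c sqn2_ge0.
move=> c0 fc; split=> //; exists c%:C => z.
by rewrite !sqn2E -rmorphM lecR.
Qed.

Lemma cvg_sqnP (U : normedModType C) (u : nat -> U) (l : U) :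
  u @ \oo --> l <->
  forall e : R, 0 < e -> \forall n \near \oo, sqn (l - u n) < e.
Proof.
split=> [/cvgrPdist_lt ul e e0|ul].
  have /ul : 0 < (Num.sqrt e)%:C :> C by rewrite ltcR sqrtr_gt0.
  apply: filterS => n; rewrite rnormE ltcR => h.
  rewrite -(sqr_sqrtr (ltW e0)) /sqn ltr_pXn2r ?nnegrE ?rnorm_ge0 ?sqrtr_ge0//.
apply/cvgrPdist_lt => e e0.
have eE : e = (complex.Re e)%:C by rewrite RRe_real// gtr0_real.
have e0' : 0 < complex.Re e by rewrite -ltcR -eE.
have := ul _ (exprn_gt0 2 e0'); apply: filterS => n.
rewrite rnormE eE ltcR /sqn ltr_pXn2r ?nnegrE ?rnorm_ge0//; exact: ltW.
Qed.

Lemma sqn_complete (U : completeNormedModType C) (u : nat -> U) (v : nat -> R) :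
  (forall m n, sqn (u (m + n)%N - u m) <= v m) ->
  (forall e, 0 < e -> exists m, v m < e) ->
  exists l : U, u @ \oo --> l.
Proof.
move=> uv v0; suff /cauchy_cvgP uc : cauchy (u @ \oo) by exists (lim (u @ \oo)).
apply: cauchy_exP => e e0.
have eE : e = (complex.Re e)%:C by rewrite RRe_real// gtr0_real.
have e0' : 0 < complex.Re e by rewrite -ltcR -eE.
have [m vm] := v0 _ (exprn_gt0 2 e0').
exists (u m); rewrite -ball_normE; exists m => // k /= mk.
rewrite /ball_/= distrC rnormE eE ltcR.
rewrite -(@ltr_pXn2r _ 2)// ?nnegrE ?rnorm_ge0 ?ltW//.
by apply: le_lt_trans vm; rewrite -(subnKC mk); exact: uv.
Qed.

(** The hypothesis forces [v] to decrease, so the excess of [v m] over its infimum bounds all later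
    increments and tends to 0. *)
Lemma sqn_telescope (U : completeNormedModType C) (u : nat -> U) (v : nat -> R) :
  (forall n, 0 <= v n) ->
  (forall m n, sqn (u (m + n)%N - u m) <= v m - v (m + n)%N) ->
  exists l : U, u @ \oo --> l.
Proof.
move=> v0 uv; have lbv : lbound (range v) 0 by move=> _ [n _ <-].
have hv : has_inf (range v).
  by split; [exists (v 0%N), 0%N|exists 0].
apply: (@sqn_complete _ _ (fun m => v m - inf (range v))) => [m n|e e0].
  by apply: le_trans (uv m n) _; rewrite lerD2l lerN2; apply: ge_inf; [case: hv|exists (m + n)%N].
have [_ [m _ <-] vm] := inf_adherent e0 hv.
by exists m; rewrite ltrBlDl.
Qed.

Lemma sqn_cvg_le (U : normedModType C) (u : nat -> U) (l : U) (c : R) :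
  u @ \oo --> l -> (forall n, sqn (u n) <= c) -> sqn l <= c.
Proof.
move=> /cvg_sqnP ul uc.
have c0 : 0 <= c by apply: le_trans (uc 0%N); exact: sqn_ge0.
suff : rnorm l <= Num.sqrt c.
  by rewrite -(@ler_pXn2r _ 2)// ?nnegrE ?rnorm_ge0 ?sqrtr_ge0// sqr_sqrtr.
(* Arguing with [rnorm] keeps the bound sharp, where [sqnD] would cost a factor 2. *)
apply/ler_addgt0Pr => e e0.
have [n _ /(_ n (leqnn n))/= h] := ul _ (exprn_gt0 2 e0).
rewrite -(subrK (u n) l) (le_trans (rnormD _ _))// addrC lerD//.
  rewrite -(@ler_pXn2r _ 2)// ?nnegrE ?rnorm_ge0 ?sqrtr_ge0// sqr_sqrtr//; exact: uc.
by rewrite -(@ler_pXn2r _ 2)// ?nnegrE ?rnorm_ge0 ?ltW//; exact: ltW.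
Qed.

Lemma cvg_linear (U W : normedModType C) (f : U -> W) (c : R) (u : nat -> U) (l : U) :
  linear f -> (forall x, sqn (f x) <= c * sqn x) ->
  u @ \oo --> l -> f \o u @ \oo --> f l.
Proof.
move=> lf fc /cvg_sqnP ul; apply/cvg_sqnP => e e0.
(* [c] carries no sign, so a positive majorant is used as divisor. *)
have c1 : 0 < `|c| + 1 by rewrite ltr_wpDl.
have := ul _ (divr_gt0 e0 c1); apply: filterS => n h /=.
rewrite -(linB lf); apply: le_lt_trans (fc _) _.
rewrite ltr_pdivlMr// in h; apply: le_lt_trans h; rewrite mulrC.
by rewrite ler_wpM2l ?sqn_ge0// ler_wpDr// ler_norm.
Qed.

End RealNorm.

(** * Positive semidefinite Hermitian forms *)

Section HermitianForms.
Context {R : realType}.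
Local Notation C := R[i].

(* The real part of a positive semidefinite sesquilinear form; it determines
   the form, and [hformJ] records that the form is sesquilinear. *)
Record hform {U : lmodType C} (b : U -> U -> R) : Prop := Hform {
  hformDl : forall x y z, b (x + y) z = b x z + b y z;
  hformZl : forall (t : R) x y, b (t%:C *: x) y = t * b x y;
  hformJ : forall (a : C) x y, b (a *: x) y = b x (a^* *: y);
  hformC : forall x y, b x y = b y x;
  hform_ge0 : forall x, 0 <= b x x
}.

Section Theory.
Context {U : lmodType C} {b : U -> U -> R} (hb : hform b).

Lemma hformNl x y : b (- x) y = - b x y.
Proof.
by rewrite -scaleN1r -(rmorph1 (real_complex R)) -rmorphN (hformZl hb) mulN1r.
Qed.

Lemma hformBl x y z : b (x - y) z = b x z - b y z.
Proof. by rewrite (hformDl hb) hformNl. Qed.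

Lemma hformDr x y z : b x (y + z) = b x y + b x z.
Proof. by rewrite (hformC hb) (hformDl hb) !(hformC hb _ x). Qed.

Lemma hformBr x y z : b x (y - z) = b x y - b x z.
Proof. by rewrite (hformC hb) hformBl !(hformC hb _ x). Qed.

Lemma hformJr a x y : b x (a *: y) = b (a^* *: x) y.
Proof. by rewrite (hformC hb) (hformJ hb) (hformC hb). Qed.

Lemma hform0l x : b 0 x = 0.
Proof. by have := hformBl 0 0 x; rewrite !subrr. Qed.

Lemma hformDD x y : b (x + y) (x + y) = b x x + 2 * b x y + b y y.
Proof. by rewrite hformDr !(hformDl hb) (hformC hb y x); ring. Qed.

Lemma hformZD (t : R) x y :
  b (x + t%:C *: y) (x + t%:C *: y) = b x x + 2 * t * b x y + t ^+ 2 * b y y.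
Proof.
by rewrite hformDD (hformC hb x) !(hformZl hb) (hformC hb y (_ *: _))
  !(hformZl hb) (hformC hb y x); ring.
Qed.

Lemma sqrB_le (x y : R) : (x - y) ^+ 2 <= 2 * (x ^+ 2 + y ^+ 2).
Proof. by rewrite -subr_ge0 (_ : _ - _ = (x + y) ^+ 2) ?sqr_ge0//; ring. Qed.

(** Evaluate the polynomial at its vertex [- c / d]. If [d = 0] it is affine, and a nonzero slope
    would let it reach -1. *)
Lemma quad_disc (a c d : R) :
  0 <= d -> (forall t, 0 <= a + 2 * t * c + t ^+ 2 * d) -> c ^+ 2 <= a * d.
Proof.
move=> d0 h; have [d00|dN0] := eqVneq d 0.
  have [->|cN0] := eqVneq c 0; first by rewrite d00 expr0n mulr0.
  have := h (- (a + 1) / (2 * c)); rewrite d00 mulr0 addr0.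
  by rewrite (_ : _ + _ = -1) ?ler0N1//; field.
have dp : 0 < d by rewrite lt_def dN0.
have := h (- c / d); rewrite (_ : _ + _ = (a * d - c ^+ 2) / d); last by field.
by rewrite pmulr_lge0 ?invr_gt0// subr_ge0.
Qed.

Lemma hform_CS x y : b x y ^+ 2 <= b x x * b y y.
Proof.
apply: quad_disc => [|t]; first exact: hform_ge0.
by rewrite -hformZD hform_ge0.
Qed.

Lemma hform_orth x y : b x y = 0 -> b (x + y) (x + y) = b x x + b y y.
Proof. by rewrite hformDD => ->; rewrite mulr0 addr0. Qed.

End Theory.

(** * Orthogonal projection onto an embedded complete space *)

Section Projection.
Context {K : completeNormedModType C} {U : lmodType C} {b : U -> U -> R}.
Variables (j : K -> U) (c d : R).
Hypotheses (hb : hform b) (lj : linear j) (d0 : 0 < d) (c0 : 0 <= c)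
  (bj_ge : forall k, d * sqn k <= b (j k) (j k))
  (bj_le : forall k, b (j k) (j k) <= c * sqn k).

Let inj_bj k : b (j k) (j k) = 0 -> k = 0.
Proof.
move=> bk; apply: sqn_eq0; rewrite -(ler_pM2l d0) mulr0.
by apply: le_trans (bj_ge k) _; rewrite bk.
Qed.

(** A minimising sequence for the distance from [u] to the range of [j] converges in [K]: the form
    is only semidefinite on [U], but its pullback along [j] is equivalent to the norm of the
    complete space [K]. *)
Lemma hform_orth_ex u : exists k, forall k', b (u - j k) (j k') = 0.
Proof.
pose f k := b (u - j k) (u - j k); pose I := inf (range f).
have hI : has_inf (range f).
  by split; [exists (f 0), 0|exists 0 => _ [k _ <-]; exact: hform_ge0].
have Ile k : I <= f k by apply: ge_inf; [case: hI|exists k].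
(* Moving [k] in the direction [v] cannot decrease [f] by more than [e]. *)
have near_orth k v e : f k <= I + e -> b (u - j k) (j v) ^+ 2 <= e * b (j v) (j v).
  move=> fk; apply: quad_disc => [|t]; first exact: hform_ge0.
  have := Ile (k - t%:C *: v); rewrite /f (linB lj) (linZ lj) opprB addrCA.
  rewrite addrC (hformZD hb) => h.
  have {}h := le_trans h (lerD (lerD fk (lexx _)) (lexx _)).
  by rewrite -(lerD2l I) addr0 !addrA.
have /choice[k kE] n : exists k, f k <= I + n.+1%:R^-1.
  have e0 : 0 < n.+1%:R^-1 :> R by rewrite invr_gt0.
  by have [_ [k _ <-] fk] := inf_adherent e0 hI; exists k; rewrite ltW.
have [l kl] : exists l : K, k @ \oo --> l.
  apply: (@sqn_complete _ _ _ (fun n => 4 / d * n.+1%:R^-1)) => [m n|e e0].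
    (* [s] is a difference of two pairings, each with square at most [s / m.+1]; hence
       [s ^+ 2 <= 4 * s / m.+1]. *)
    set v := k _ - k m; have := near_orth _ v _ (kE m).
    have := near_orth _ v _ (kE (m + n)%N).
    set s := b (j v) (j v) => h1 h2.
    have sE : s = b (u - j (k m)) (j v) - b (u - j (k (m + n)%N)) (j v).
      by rewrite -(hformBl hb) opprB addrC subrKA -(linB lj).
    have : s <= 4 * m.+1%:R^-1.
      have [->|sN0] := eqVneq s 0; first by rewrite mulr_ge0 ?invr_ge0.
      have sp : 0 < s by rewrite lt_def sN0 hform_ge0.
      have mn : (m + n).+1%:R^-1 <= m.+1%:R^-1 :> R.
        by rewrite lef_pV2 ?posrE// ler_nat ltnS leq_addr.
      rewrite -(ler_pM2r sp) -expr2 {1}sE.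
      move: (b _ _) (b _ _) h1 h2 => p q h1 h2.
      apply: (@le_trans _ _ (2 * (p ^+ 2 + q ^+ 2))).
        exact: sqrB_le.
      rewrite (_ : 4 * _ * s = 2 * (m.+1%:R^-1 * s + m.+1%:R^-1 * s)); last by ring.
      rewrite ler_pM2l// lerD//; apply: le_trans h1 _.
      by rewrite ler_pM2r.
    move=> sm; rewrite mulrAC ler_pdivlMr// mulrC.
    exact: le_trans (bj_ge v) sm.
  have d4 : 0 < d / 4 * e by rewrite !mulr_gt0 ?invr_gt0.
  have [n _ /(_ n (leqnn n)) h] := near_infty_natSinv_lt (PosNum d4).
  exists n; rewrite (_ : e = 4 / d * (d / 4 * e)); last by field; rewrite gt_eqF.
  by rewrite ltr_pM2l// divr_gt0.
exists l => v; set s := b _ _.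
suff : s ^+ 2 <= 0.
  by move=> h; apply/eqP; rewrite -sqrf_eq0; apply/eqP/le_anti; rewrite h sqr_ge0.
apply/ler_addgt0Pr => e e0; rewrite add0r.
set a := b (j v) (j v); have a0 : 0 <= a by exact: hform_ge0.
(* Below, [s = p - q], with [p] small by near-orthogonality and [q] small by Cauchy-Schwarz; this
   [t] makes the total exactly [e]. Using [a + 1] covers [a = 0]. *)
pose t := e / (2 * (1 + c) * (a + 1)).
have D0 : 0 < 2 * (1 + c) * (a + 1) by rewrite mulr_gt0 ?mulr_gt0 ?[0 < 1 + _]ltr_pwDl// ltr_wpDl.
have t0 : 0 < t by rewrite divr_gt0.
move/cvg_sqnP : kl => /(_ _ t0) kl.
have [n [nt nl]] : exists n, n.+1%:R^-1 < t /\ sqn (l - k n) < t.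
  have : \forall n \near \oo, n.+1%:R^-1 < t /\ sqn (l - k n) < t.
    by apply: filterI kl; exact: (near_infty_natSinv_lt (PosNum t0)).
  by move=> [n _ /(_ n (leqnn n))]; exists n.
have sE : s = b (u - j (k n)) (j v) - b (j (l - k n)) (j v).
  by rewrite -(hformBl hb) (linB lj) opprB subrKA.
have h1 := near_orth _ v _ (kE n).
have h2 := hform_CS hb (j (l - k n)) (j v).
rewrite sE; set p := b (u - j (k n)) (j v) in h1 *.
set q := b (j (l - k n)) (j v) in h2 *.
apply: (@le_trans _ _ (2 * (p ^+ 2 + q ^+ 2))).
  exact: sqrB_le.
rewrite -/a in h1 h2.
apply: (@le_trans _ _ (2 * (t * (a + 1) + c * t * (a + 1)))).
  rewrite ler_pM2l// lerD//.
    apply: le_trans h1 _; apply: ler_pM => //; last by rewrite lerDl.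
    exact: ltW.
  apply: le_trans h2 _; apply: ler_pM => //; last by rewrite lerDl.
    exact: hform_ge0.
  by apply: le_trans (bj_le _) _; rewrite ler_wpM2l// ltW.
rewrite (_ : 2 * _ = t * (2 * (1 + c) * (a + 1))); last by ring.
by rewrite /t divfK// gt_eqF.
Qed.

(** The orthogonal foot is unique because [j] is bounded below for [b]; uniqueness makes the chosen
    map linear and a left inverse of [j], and Pythagoras gives the norm bound. *)
Lemma hform_proj : exists P : U -> K,
  [/\ linear P, (forall u k, b (u - j (P u)) (j k) = 0),
      (forall k, P (j k) = k) & (forall u, b (j (P u)) (j (P u)) <= b u u)].
Proof.
have /choice[P PE] := hform_orth_ex.
have uniq u k : (forall k', b (u - j k) (j k') = 0) -> P u = k.
  move=> kE; apply/subr0_eq/inj_bj; rewrite {1}(linB lj).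
  rewrite (_ : j (P u) - j k = (u - j k) - (u - j (P u))).
    by rewrite (hformBl hb) kE PE subrr.
  by rewrite opprB [RHS]addrC subrKA.
exists P; split => // [a x y|k|u].
- apply: uniq => k; rewrite lj opprD addrACA -scalerBr (hformDl hb) PE addr0.
  by rewrite (hformJ hb) -(linZ lj) PE.
- by apply: uniq => k'; rewrite subrr (hform0l hb).
- rewrite -[in leRHS](subrK (j (P u)) u) (hform_orth hb (PE _ _)) lerDr.
  exact: hform_ge0.
Qed.

End Projection.
End HermitianForms.

(** * Forms arising from Hilbert space inner products *)

Section HilbertForms.
Context {R : realType}.
Local Notation C := R[i].

Definition rip {H : normedModType C} (ipH : inner_product H) (x y : H) : R :=
  complex.Re (ip ipH x y).

Lemma rip_sqn (H : normedModType C) (ipH : inner_product H) x :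
  rip ipH x x = sqn x.
Proof. by rewrite /rip ip_norm sqnE. Qed.

Lemma ipDl (H : normedModType C) (ipH : inner_product H) x y z :
  ip ipH (x + y) z = ip ipH x z + ip ipH y z.
Proof. by rewrite -[x in LHS]scale1r ip_linear mul1r. Qed.

Lemma ipZl (H : normedModType C) (ipH : inner_product H) a x y :
  ip ipH (a *: x) y = a * ip ipH x y.
Proof.
have ip0 : ip ipH 0 y = 0.
  by apply: (addIr (ip ipH 0 y)); rewrite -ipDl addr0 add0r.
by rewrite -[a *: x]addr0 ip_linear ip0 addr0.
Qed.

Lemma hform_rip (H : normedModType C) (ipH : inner_product H) :
  hform (rip ipH).
Proof.
rewrite /rip; split=> [x y z|t x y|a x y|x y|x].
- by rewrite ipDl raddfD.
- by rewrite ipZl; case: (ip _ _ _) => p q /=; rewrite mul0r subr0.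
- by rewrite (ip_conj ipH (_ *: y)) !ipZl rmorphM/= conjcK -ip_conj.
- by rewrite ip_conj; case: (ip _ _ _).
- by rewrite -/(rip _ _ _) rip_sqn sqn_ge0.
Qed.

Lemma hform_comp (U W : lmodType C) (b : W -> W -> R) (f : U -> W) :
  linear f -> hform b -> hform (fun x y => b (f x) (f y)).
Proof.
move=> lf hb; split=> [x y z|t x y|a x y|x y|x].
- by rewrite (linD lf) (hformDl hb).
- by rewrite (linZ lf) (hformZl hb).
- by rewrite !(linZ lf) (hformJ hb).
- exact: hformC.
- exact: hform_ge0.
Qed.

Lemma hform_prod (K H : lmodType C) (a : K -> K -> R) (b : H -> H -> R) :
  hform a -> hform b ->
  hform (fun z w : K * H => a z.1 w.1 + b z.2 w.2).
Proof.
move=> ha hb; split=> [x y z|t x y|s x y|x y|x] /=.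
- by rewrite (hformDl ha) (hformDl hb) addrACA.
- by rewrite (hformZl ha) (hformZl hb) mulrDr.
- by rewrite (hformJ ha) (hformJ hb).
- by rewrite (hformC ha) (hformC hb).
- by rewrite addr_ge0 ?(hform_ge0 ha) ?(hform_ge0 hb).
Qed.

(** * Splitting a contractive extension of an isometry *)

Section Splitting.
Context {K H : completeNormedModType C} (ipH : inner_product H).
Context {T : K -> K} {V : H -> H} {X : H -> K} {a : K -> K -> R} {d : H -> H -> R}.
Context {cT c alpha : R}.
Hypotheses (lT : linear T) (Tb : forall x, sqn (T x) <= cT * sqn x)
  (lV : linear V) (iV : forall h, sqn (V h) = sqn h) (lX : linear X)
  (ha : hform a) (alpha0 : 0 < alpha)
  (a_ge : forall k, alpha * sqn k <= a k k)
  (hd : hform d) (c0 : 0 <= c) (d_le : forall h, d h h <= c * sqn h)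
  (contr : forall k h, a (T k + X h) (T k + X h) + d (V h) (V h) <= a k k + d h h).

(** The factor [c] alone could give a degenerate form; the extra 1 makes [b] dominate [sqn]. *)
Let b x y := (c + 1) * rip ipH x y - d x y.

Let bE h : b h h = (c + 1) * sqn h - d h h.
Proof. by rewrite /b rip_sqn. Qed.

Let b_ge h : sqn h <= b h h.
Proof. by rewrite bE mulrDl mul1r; have := d_le h; lra. Qed.

Let b_le h : b h h <= (c + 1) * sqn h.
Proof. by rewrite bE gerBl hform_ge0. Qed.

Let hb : hform b.
Proof.
have hr := hform_rip ipH; split=> [x y z|t x y|s x y|x y|x]; rewrite /b.
- by rewrite (hformDl hr) (hformDl hd); ring.
- by rewrite (hformZl hr) (hformZl hd); ring.
- by rewrite (hformJ hr) (hformJ hd).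
- by rewrite (hformC hr) (hformC hd).
- exact: le_trans (sqn_ge0 x) (b_ge x).
Qed.

(* [V] expands [b] by exactly the amount that [contr] lets [X] add to [a];
   this is what keeps [a (L h) <= b h] stable under the iteration below. *)
Let bV h : b (V h) (V h) = b h h + (d h h - d (V h) (V h)).
Proof. by rewrite !bE iV; ring. Qed.

Lemma contractive_extension_splits : exists L : H -> K,
  [/\ linear L, (exists2 c', 0 <= c' & forall h, sqn (L h) <= c' * sqn h)
    & forall h, X h = L (V h) - T (L h)].
Proof.
have [W [lW _ WV bVW]] : exists W : H -> H, [/\ linear W,
    forall u k, b (u - V (W u)) (V k) = 0, forall k, W (V k) = k &
    forall u, b (V (W u)) (V (W u)) <= b u u].
  apply: (hform_proj (c := c + 1) (d := 1) hb lV) => // [|k|k].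
  - by rewrite addr_ge0.
  - by rewrite mul1r -(iV k); exact: b_ge.
  - by rewrite -(iV k); exact: b_le.
(* A fixed point [F] of this iteration satisfies [F (V h) = T (F h) + X h], because [W] is a left
   inverse of [V]. *)
pose L n := iter n (fun F h => T (F (W h)) + X (W h)) (fun=> 0).
have LS n h : L n.+1 h = T (L n (W h)) + X (W h) by [].
have lL n : linear (L n).
  elim: n => [|n IH] s x y; first by rewrite scaler0 addr0.
  by rewrite !LS lW IH lT lX scalerDr addrACA.
have aT k : a (T k) (T k) <= a k k.
  by have := contr k 0; rewrite (lin0 lV) (lin0 lX) (hform0l hd) !addr0.
have aTn m k : a (iter m T k) (iter m T k) <= a k k.
  by elim: m => //= m IH; exact: le_trans (aT _) IH.
(* Apply [contr] at the pair [L n (W h)], [W h]: by [bV] the [d] terms turn [b (W h)] into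
   [b (V (W h))], which [bVW] bounds by [b h]. *)
have aL n h : a (L n h) (L n h) <= b h h - b (iter n W h) (iter n W h).
  elim: n h => [|n IH] h; first by rewrite /L/= (hform0l ha) subrr.
  rewrite LS iterSr; have := contr (L n (W h)) (W h); have := IH (W h).
  by have := bVW h; rewrite bV; lra.
(* Isolates the tail of the series. As [T] contracts [a], [aL] at [iter m W h] bounds the tail by a
   telescoping difference. *)
have LD m n h : L (m + n)%N h = L m h + iter m T (L n (iter m W h)).
  elim: m h => [|m IH] h; first by rewrite add0r.
  by rewrite addSn !LS IH (linD lT) addrAC [iter m.+1 W h]iterSr.
have sqn_a k : sqn k <= a k k / alpha.
  by rewrite ler_pdivlMr// mulrC.
have /choice[L' L'E] h : exists l : K, L n h @[n --> \oo] --> l.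
  apply: (@sqn_telescope _ _ _ (fun n => b (iter n W h) (iter n W h) / alpha)).
    by move=> n; rewrite divr_ge0 ?(hform_ge0 hb)// ltW.
  move=> m n; rewrite LD addrC addKr -mulrBl.
  apply: le_trans (sqn_a _) _; rewrite ler_pM2r ?invr_gt0//.
  by apply: le_trans (aTn _ _) _; rewrite addnC iterD aL.
have L'_unique h l : L n h @[n --> \oo] --> l -> l = L' h.
  by move=> ll; apply: (cvg_unique _ ll (L'E h)); exact: norm_hausdorff.
exists L'; split=> [s x y||h].
- apply/esym/L'_unique; rewrite (_ : (fun n => _) = (fun n => s *: L n x + L n y)).
    by apply: cvgD; [apply: cvgZr|]; exact: L'E.
  by apply/funext => n; exact: lL.
- exists ((c + 1) / alpha) => [|h]; first by rewrite divr_ge0 ?addr_ge0// ltW.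
  apply: sqn_cvg_le (L'E h) _ => n; apply: le_trans (sqn_a _) _.
  rewrite mulrAC ler_pM2r ?invr_gt0//; apply: le_trans (aL _ _) _.
  by apply: le_trans (b_le h); rewrite gerBl (hform_ge0 hb).
- apply/eqP; rewrite eq_sym subr_eq; apply/eqP/esym/L'_unique.
  rewrite -cvg_shiftS (_ : (fun n => _) = (fun n => X h + T (L n h))).
    by apply: cvgD; [exact: cvg_cst|exact: cvg_linear lT Tb (L'E h)].
  by apply/funext => n; rewrite LS WV addrC.
Qed.

End Splitting.
End HilbertForms.

(** * Similarity to a contraction in terms of [X = L V - T L] *)

Section Similarity.
Context {R : realType} {K H : completeNormedModType R[i]}.
Context (ipK : inner_product K) (ipH : inner_product H).
Context {T : K -> K} {V : H -> H} {X : H -> K}.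
Hypotheses (lT : linear T) (lV : linear V) (lX : linear X)
  (T_le : forall k, sqn (T k) <= sqn k) (iV : forall h, sqn (V h) = sqn h).

(** The shear by [L] conjugates [Rop T V X] to the direct sum of [T] and [V]. *)
Lemma similar_of_split (L : H -> K) (c : R) :
  linear L -> 0 <= c -> (forall h, sqn (L h) <= c * sqn h) ->
  (forall h, X h = L (V h) - T (L h)) -> similar_to_contraction (Rop T V X).
Proof.
move=> lL c0 Lc XE.
have bnd (z : K * H) : 2 * sqn z.1 + 2 * sqn (L z.2) + sqn z.2 <= (2 + 2 * c) * sqn2 z.
  rewrite /sqn2; have := Lc z.2; have := sqn_ge0 z.1; have := sqn_ge0 z.2.
  have := mulr_ge0 c0 (sqn_ge0 z.1); lra.
have c2 : 0 <= 2 + 2 * c by lra.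
exists (fun z => (z.1 + L z.2, z.2)), (fun z => (z.1 - L z.2, z.2)); split.
- apply/bounded_op2_sqnP; split=> [s z w|].
    by congr pair; rewrite /= lL scalerDr addrACA.
  exists (2 + 2 * c) => // z; apply: le_trans _ (bnd z).
  by rewrite /sqn2/= lerD2r sqnD.
- apply/bounded_op2_sqnP; split=> [s z w|].
    by congr pair; rewrite /= lL opprD scalerDr scalerN addrACA.
  exists (2 + 2 * c) => // z; apply: le_trans _ (bnd z).
  by rewrite /sqn2/= lerD2r sqnB.
- by move=> [k h]; rewrite /= subrK.
- by move=> [k h]; rewrite /= addrK.
- move=> [k h]; rewrite !sqn2E lecR /Rop /sqn2/= iV lerD2r XE (linD lT).
  by rewrite [L (V h) - _]addrC addrA !addrK T_le.
Qed.

Lemma split_of_similar : similar_to_contraction (Rop T V X) ->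
  exists L : H -> K, [/\ linear L,
    (exists2 c, 0 <= c & forall h, sqn (L h) <= c * sqn h)
    & forall h, X h = L (V h) - T (L h)].
Proof.
move=> [S [S' [/bounded_op2_sqnP[lS [cS cS0 Sc]] /bounded_op2_sqnP[lS' [c c0 S'c]]]]].
move=> SK SK' contr.
(* The norm transported by [S'], in which [Rop T V X] is a contraction. *)
pose p z w := rip ipK (S' z).1 (S' w).1 + rip ipH (S' z).2 (S' w).2.
have hp : hform p.
  exact: hform_comp lS' (hform_prod (hform_rip ipK) (hform_rip ipH)).
have pE z : p z z = sqn2 (S' z) by rewrite /p !rip_sqn.
have p_le (z : K * H) : p z z <= c * sqn2 z by rewrite pE.
pose alpha := (cS + 1)^-1.
have alpha0 : 0 < alpha by rewrite invr_gt0 ltr_wpDl.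
have p_ge z : alpha * sqn2 z <= p z z.
  rewrite /alpha mulrC ler_pdivrMr ?ltr_wpDl// pE mulrC mulrDl mul1r.
  by rewrite -[in leLHS](SK z); apply: le_trans (Sc _) _; rewrite lerDl sqn2_ge0.
have pR z : p (Rop T V X z) (Rop T V X z) <= p z z.
  by rewrite !pE -lecR -!sqn2E; have := contr (S' z); rewrite SK.
have sqn2k (k : K) : sqn2 (k, 0 : H) = sqn k by rewrite /sqn2/= sqn0 addr0.
have sqn2h (h : H) : sqn2 (0 : K, h) = sqn h by rewrite /sqn2/= sqn0 add0r.
pose j (k : K) : K * H := (k, 0).
have lj : linear j by move=> s x y; congr pair; rewrite /= scaler0 addr0.
have [P [lP Porth _ P_le]] : exists P : K * H -> K, [/\ linear P,
    forall u k, p (u - j (P u)) (j k) = 0, forall k, P (j k) = k &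
    forall u, p (j (P u)) (j (P u)) <= p u u].
  by apply: (hform_proj (c := c) hp lj alpha0 c0) => k; rewrite -(sqn2k k).
pose M h := P (0, h).
have li : linear (fun h : H => (0 : K, h)).
  by move=> s x y; congr pair; rewrite /= scaler0 addr0.
have lM : linear M by move=> s x y; rewrite /M li lP.
(* The coordinates [j k + u h] are [p]-orthogonal, and in them the operator is again triangular,
   with corner [X']. *)
pose u h : K * H := (0, h) - j (M h).
have lu : linear u.
  by move=> s x y; rewrite /u li lM lj scalerBr opprD addrACA.
have orth k h : p (j k) (u h) = 0 by rewrite (hformC hp) Porth.
have Mc h : alpha * sqn (M h) <= c * sqn h.
  rewrite -sqn2k -(sqn2h h); apply: le_trans (p_ge _) _.
  exact: le_trans (P_le _) (p_le _).
pose X' h := X h + M (V h) - T (M h).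
have lX' : linear X'.
  move=> s x y; rewrite /X' lX lV lM lM lT !scalerDr scalerN opprD.
  by rewrite (addrACA (s *: X x)) [LHS]addrACA.
have Ru k h : Rop T V X (j k + u h) = j (T k + X' h) + u (V h).
  congr pair; rewrite /= !(sub0r, subr0, add0r)//.
  by rewrite (linB lT) /X' -!(addrA (T k)) [in RHS]addrAC addrK [- _ + _]addrC.
have [L [lL [c' c'0 Lc] LE]] : exists L : H -> K, [/\ linear L,
    (exists2 c', 0 <= c' & forall h, sqn (L h) <= c' * sqn h)
    & forall h, X' h = L (V h) - T (L h)].
  apply: (contractive_extension_splits ipH (cT := 1) (c := c) lT _ lV iV lX'
    (hform_comp lj hp) alpha0 _ (hform_comp lu hp) c0).
  - by move=> k; rewrite mul1r; exact: T_le.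
  - by move=> k; rewrite -(sqn2k k); exact: p_ge.
  - move=> h; rewrite -(sqn2h h); apply: le_trans _ (p_le _).
    rewrite -[in leRHS](subrK (j (M h)) (0, h)) (hform_orth hp (Porth _ _)).
    by rewrite lerDl (hform_ge0 hp).
  - move=> k h; rewrite -(hform_orth hp (orth _ _)) -(hform_orth hp (orth _ _)).
    by rewrite -Ru.
(* Subtracting [M] undoes the shear: [X'] differs from [X] by [M V - T M]. *)
exists (fun h => L h - M h); split.
- exact: linear_sub lL lM.
- exists (2 * c' + 2 * (c / alpha)) => [|h].
    apply: addr_ge0; apply: mulr_ge0 => //.
    by apply: divr_ge0 => //; exact: ltW.
  apply: le_trans (sqnB _ _) _; rewrite (mulrDl (2 * c')) -!mulrA lerD// ler_pM2l//.
  by rewrite mulrCA ler_pdivlMl.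
- move=> h; rewrite (linB lT).
  rewrite opprB [T _ - _]addrC addrACA -LE /X' addrA.
  by rewrite (addrAC _ (- T _)) addrK subrK.
Qed.

End Similarity.

(** * An isometry and its adjoint; applied later to the powers of [V] as well *)

Section Shift.
Context {R : realType} {H : completeNormedModType R[i]} (ipH : inner_product H).
Context {V Vs : H -> H}.
Hypotheses (lV : linear V) (iV : forall h, sqn (V h) = sqn h)
  (adjV : forall x y, rip ipH (V x) y = rip ipH x (Vs y)).
Let hr := hform_rip ipH.

Lemma rip_inj x y : (forall z, rip ipH z x = rip ipH z y) -> x = y.
Proof.
move=> xy; apply/subr0_eq/sqn_eq0.
by rewrite -(rip_sqn ipH) (hformBr hr) xy subrr.
Qed.

Lemma rip_isometry x y : rip ipH (V x) (V y) = rip ipH x y.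
Proof.
have := hformDD hr (V x) (V y); have := hformDD hr x y.
rewrite -(linD lV) !rip_sqn !iV; lra.
Qed.

Lemma adjoint_linear : linear Vs.
Proof.
move=> s x y; apply: rip_inj => z.
by rewrite -adjV !(hformDr hr) !(hformJr hr) -!adjV (linZ lV).
Qed.

Lemma adjoint_isometryK h : Vs (V h) = h.
Proof. by apply: rip_inj => z; rewrite -adjV rip_isometry. Qed.

(** Pythagoras for the orthogonal projection [V Vs] onto the range of [V]. *)
Lemma sqn_adjoint_split h : sqn (h - V (Vs h)) = sqn h - sqn (Vs h).
Proof.
have orth : rip ipH (V (Vs h)) (h - V (Vs h)) = 0.
  by rewrite adjV (linB adjoint_linear) adjoint_isometryK subrr (hformC hr) (hform0l hr).
have := hform_orth hr orth; rewrite [V _ + _]addrC subrK !rip_sqn iV => ->.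
by rewrite addrAC subrr add0r.
Qed.

End Shift.

(** * Wold decomposition of a pure isometry *)

Section Wold.
Context {R : realType} {H : completeNormedModType R[i]} (ipH : inner_product H).
Context {V Vs : H -> H}.
Hypotheses (lV : linear V) (iV : forall h, sqn (V h) = sqn h)
  (adjV : forall x y, rip ipH (V x) y = rip ipH x (Vs y)).
Let hr := hform_rip ipH.
Let lVs := adjoint_linear lV adjV.
Let VsK := adjoint_isometryK lV iV adjV.

Let iVn n h : sqn (iter n V h) = sqn h.
Proof. by elim: n => //= n IH; rewrite iV. Qed.

Let adjVn n x y : rip ipH (iter n V x) y = rip ipH x (iter n Vs y).
Proof. by elim: n x => // n IH x; rewrite iterSr IH adjV -iterS. Qed.

(** The kernel of [Vs] is orthogonal to the range of [V]; factoring one [V] out of the later terms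
    gives the induction. *)
Lemma sqn_sum_wandering N (x : nat -> H) : (forall n, (n < N)%N -> Vs (x n) = 0) ->
  sqn (\sum_(n < N) iter n V (x n)) = \sum_(n < N) sqn (x n).
Proof.
elim: N x => [|N IH] x xM; first by rewrite !big_ord0 sqn0.
rewrite !big_ord_recl/=.
rewrite (_ : \sum_(i < N) _ = V (\sum_(i < N) iter i V (x i.+1))); last first.
  by rewrite (big_morph V (linD lV) (lin0 lV)).
have orth : rip ipH (V (\sum_(i < N) iter i V (x i.+1))) (x 0%N) = 0.
  by rewrite adjV xM// (hformC hr) (hform0l hr).
rewrite addrC -(rip_sqn ipH) (hform_orth hr orth) !rip_sqn iV addrC (IH (fun n => x n.+1))//.
by move=> n nN; exact: xM.
Qed.

Hypothesis pureV : forall x, (forall n, exists y, x = iter n V y) -> x = 0.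

(** The vectors [D n] are projections of [h] onto decreasing ranges, so they converge. The limit is
    fixed by every [iter m V (iter m Vs _)], hence lies in all ranges, and purity makes it 0. *)
Lemma pure_isometry_cvg0 h : iter n V (iter n Vs h) @[n --> \oo] --> (0 : H).
Proof.
pose D n := iter n V (iter n Vs h).
have VnK m g : iter m Vs (iter m V g) = g.
  exact: adjoint_isometryK (linear_iter _ lV) (iVn m) (adjVn m) g.
have [l Dl] : exists l : H, D n @[n --> \oo] --> l.
  apply: (@sqn_telescope _ _ _ (fun n => sqn (iter n Vs h))) => [n|m n].
    exact: sqn_ge0.
  set g := iter m Vs h.
  have -> : D (m + n)%N - D m = - iter m V (g - iter n V (iter n Vs g)).
    by rewrite (linB (linear_iter _ lV)) opprB /D iterD addnC iterD.
  rewrite sqnN iVn addnC iterD.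
  by rewrite (sqn_adjoint_split (linear_iter _ lV) (iVn n) (adjVn n)).
suff -> : 0 = l by [].
apply/esym/pureV => m; exists (iter m Vs l).
pose Q x := iter m V (iter m Vs x).
have lQ : linear Q.
  by move=> s x y; rewrite /Q (linear_iter _ lVs) (linear_iter _ lV).
have Q_le x : sqn (Q x) <= 1 * sqn x.
  rewrite iVn mul1r -subr_ge0.
  by rewrite -(sqn_adjoint_split (linear_iter _ lV) (iVn m) (adjVn m)) sqn_ge0.
have Dml : [sequence D (n + m)%N]_n @ \oo --> l by rewrite cvg_shiftn.
have := cvg_linear lQ Q_le Dml.
rewrite (_ : Q \o _ = [sequence D (n + m)%N]_n) => [Dm|].
  exact: (cvg_unique (@norm_hausdorff _ _) Dml Dm).
by apply/funext => n /=; rewrite /Q /D addnC iterD VnK.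
Qed.

End Wold.

(** * Quadratic nearness and the equation [A = L V - T L] *)

Section QuadraticNearness.
Context {R : realType} {K H : completeNormedModType R[i]} (ipH : inner_product H).
Context {T : K -> K} {V Vs : H -> H} {A : H -> K} {cT cA : R}.
Hypotheses (lT : linear T) (Tb : forall k, sqn (T k) <= cT * sqn k)
  (lV : linear V) (iV : forall h, sqn (V h) = sqn h)
  (adjV : forall x y, rip ipH (V x) y = rip ipH x (Vs y))
  (lA : linear A) (Ab : forall h, sqn (A h) <= cA * sqn h).
Let lVs := adjoint_linear lV adjV.
Let VsK := adjoint_isometryK lV iV adjV.

Definition orbit n h := (iter n (Rop T V A) (0, h)).1.

Lemma iter_Rop2 (B : H -> K) n z : (iter n (Rop T V B) z).2 = iter n V z.2.
Proof. by elim: n => //= n ->. Qed.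

Lemma orbitS n h : orbit n.+1 h = T (orbit n h) + A (iter n V h).
Proof. by rewrite /orbit iterS /Rop/= iter_Rop2. Qed.

Lemma orbit_linear n : linear (orbit n).
Proof.
elim: n => [|n IH] s x y; first by rewrite /orbit/= scaler0 addr0.
by rewrite !orbitS IH lT (linear_iter _ lV) lA scalerDr addrACA.
Qed.

Let iter_Rop0 n h : (iter n (Rop T V (fun=> 0)) (0, h)).1 = 0.
Proof. by elim: n => //= n ->; rewrite addr0 (lin0 lT). Qed.

(** Both powers act as [V^n] on the second coordinate, and the first coordinate of the unperturbed
    orbit is 0, so only [orbit] survives. *)
Lemma quad_near_orbitP :
  quad_near (Rop T V A) (Rop T V (fun=> 0)) (fun h => Vs h = 0) <->
  exists2 s : R, 0 <= s & forall N (x : nat -> H),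
    (forall n, (n < N)%N -> Vs (x n) = 0) ->
    sqn (\sum_(n < N) orbit n (x n)) <= s * \sum_(n < N) sqn (x n).
Proof.
have lhsE N (x : nat -> H) : sqnorm2 (\big[@add2 _ K H/(0, 0)]_(n < N)
    sub2 (iter n (Rop T V A) (0, x n)) (iter n (Rop T V (fun=> 0)) (0, x n)))
    = (sqn (\sum_(n < N) orbit n (x n)))%:C.
  rewrite sqn2E /sqn2 (big_morph fst (id1 := 0) (op1 := +%R))//.
  rewrite (big_morph snd (id1 := 0) (op1 := +%R))//.
  rewrite [X in _ + sqn X]big1 => [|n _]; last by rewrite /= !iter_Rop2 subrr.
  rewrite sqn0 addr0; congr (sqn _)%:C.
  by apply: eq_bigr => n _; rewrite /= iter_Rop0 subr0.
have rhsE N (x : nat -> H) (s : R) : s%:C ^+ 2 * (\sum_(n < N) `|x n| ^+ 2)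
    = (s ^+ 2 * \sum_(n < N) sqn (x n))%:C.
  rewrite rmorphM rmorphXn rmorph_sum/=; congr (_ * _).
  by apply: eq_bigr => n _; rewrite sqnE.
split=> -[s]; last first.
  move=> s0 hs; exists (Num.sqrt s)%:C; rewrite ler0c sqrtr_ge0; split=> // N x xM.
  by rewrite lhsE rhsE lecR sqr_sqrtr//; apply: hs => n nN; exact: xM.
case=> s0 hs; have sE : s = (complex.Re s)%:C by rewrite RRe_real// ger0_real.
exists (complex.Re s ^+ 2); first exact: sqr_ge0.
case=> [|N] x xM; first by rewrite !big_ord0 sqn0 mulr0.
by have := hs N x xM; rewrite lhsE sE rhsE lecR.
Qed.

(** On the kernel of [Vs], where [L] vanishes, [orbit n] telescopes to [L V^n]; orthogonality of the
    wandering subspaces finishes. *)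
Lemma quad_near_of_split (L : H -> K) (c : R) :
  linear L -> 0 <= c -> (forall h, sqn (L h) <= c * sqn h) ->
  (forall h, A h = L (V h) - T (L h)) -> (forall h, Vs h = 0 -> L h = 0) ->
  quad_near (Rop T V A) (Rop T V (fun=> 0)) (fun h => Vs h = 0).
Proof.
move=> lL c0 Lc AE L0; apply/quad_near_orbitP; exists c => // N x xM.
have orbitE n h : Vs h = 0 -> orbit n h = L (iter n V h).
  move=> h0; elim: n => [|n IH]; first by rewrite L0.
  by rewrite orbitS IH AE addrC subrK.
rewrite (eq_bigr (fun n : 'I_N => L (iter n V (x n)))) => [|n _]; last first.
  by rewrite orbitE ?xM.
rewrite -(big_morph L (linD lL) (lin0 lL)); apply: le_trans (Lc _) _.
by rewrite (sqn_sum_wandering lV iV adjV).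
Qed.

Hypothesis pureV : forall x, (forall n, exists y, x = iter n V y) -> x = 0.

Lemma split_of_quad_near :
  quad_near (Rop T V A) (Rop T V (fun=> 0)) (fun h => Vs h = 0) ->
  exists L : H -> K, [/\ linear L,
    (exists2 c, 0 <= c & forall h, sqn (L h) <= c * sqn h)
    & forall h, A h = L (V h) - T (L h)].
Proof.
move=> /quad_near_orbitP[s s0 hs].
(* The [n]-th Wold coordinate of [h]: the component of [iter n Vs h] in the kernel of [Vs]. Thus
   [Y N] below is the partial sum of the desired [L]. *)
pose w n h := iter n Vs h - V (iter n.+1 Vs h).
have lw n : linear (w n).
  exact: linear_sub (linear_iter n lVs) (linear_comp lV (linear_iter n.+1 lVs)).
have wM n h : Vs (w n h) = 0 by rewrite (linB lVs) VsK subrr.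
have wV n h : w n.+1 (V h) = w n h by rewrite /w !iterSr VsK.
have w0V h : w 0%N (V h) = 0 by rewrite /w/= VsK subrr.
have sqn_w n h : sqn (w n h) = sqn (iter n Vs h) - sqn (iter n.+1 Vs h).
  exact: sqn_adjoint_split lV iV adjV _.
pose Y N h := \sum_(n < N) orbit n (w n h).
have lY N : linear (Y N).
  move=> t x y; rewrite /Y scaler_sumr -big_split; apply: eq_bigr => n _.
  by rewrite lw orbit_linear.
have Y_tail m n h : sqn (Y (m + n)%N h - Y m h) <=
    s * (sqn (iter m Vs h) - sqn (iter (m + n) Vs h)).
  (* Nearness is applied to the coordinates from index [m] on, padded by zeros; [sqn_w] then
     telescopes the bound. *)
  pose x k := if (k < m)%N then 0 else w k h.
  have -> : Y (m + n)%N h - Y m h = \sum_(k < m + n) orbit k (x k).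
    rewrite /Y !big_split_ord/= addrAC subrr add0r.
    rewrite [X in _ = X + _]big1 ?add0r => [|k _]; last first.
      by rewrite /x ltn_ord (lin0 (orbit_linear k)).
    by apply: eq_bigr => k _; rewrite /x ltnNge leq_addr.
  apply: le_trans (hs _ _ _) _ => [k _|].
    by rewrite /x; case: ifP => // _; rewrite (lin0 lVs).
  rewrite ler_wpM2l// big_split_ord/= [X in X + _]big1 ?add0r => [|k _]; last first.
    by rewrite /x ltn_ord sqn0.
  rewrite (eq_bigr (fun k : 'I_n => sqn (iter (m + k) Vs h)
    - sqn (iter (m + k.+1) Vs h))) => [|k _]; last first.
    by rewrite /x ltnNge leq_addr sqn_w addnS.
  rewrite -(big_mkord xpredT (fun k => sqn (iter (m + k) Vs h)
    - sqn (iter (m + k.+1) Vs h))).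
  rewrite (eq_bigr (fun k => - (sqn (iter (m + k.+1) Vs h)
    - sqn (iter (m + k) Vs h)))) => [|k _]; last by rewrite opprB.
  by rewrite sumrN telescope_sumr// addn0 opprB.
have /choice[L LE] h : exists l : K, Y n h @[n --> \oo] --> l.
  apply: (@sqn_telescope _ _ _ (fun n => s * sqn (iter n Vs h))) => [n|m n].
    by rewrite mulr_ge0 ?sqn_ge0.
  by rewrite -mulrBr.
have L_unique h l : Y n h @[n --> \oo] --> l -> l = L h.
  by move=> ll; apply: (cvg_unique _ ll (LE h)); exact: norm_hausdorff.
exists L; split=> [t x y||h].
- apply/esym/L_unique; rewrite (_ : (fun n => _) = (fun n => t *: Y n x + Y n y)).
    by apply: cvgD; [apply: cvgZr|]; exact: LE.
  by apply/funext => n; exact: lY.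
- exists s => // h; apply: sqn_cvg_le (LE h) _ => n.
  have := Y_tail 0%N n h; rewrite add0n /Y big_ord0 subr0 => h1.
  by apply: le_trans h1 _; rewrite ler_wpM2l// gerBl sqn_ge0.
- apply/eqP; rewrite eq_sym subr_eq; apply/eqP/esym/L_unique.
  (* Passing from [h] to [V h] shifts the Wold coordinates by one, so [orbitS] expresses
     [Y N.+1 (V h)] through [T (Y N h)] and [A] of a partial Wold sum. That sum tends to [h] by
     purity. *)
  rewrite -cvg_shiftS (_ : (fun n => _) =
    (fun n => A (h - iter n V (iter n Vs h)) + T (Y n h))).
    apply: cvgD; last exact: cvg_linear lT Tb (LE h).
    rewrite -[X in _ --> A X]subr0; apply: (cvg_linear lA Ab).
    apply: cvgB; [exact: cvg_cst|].
    exact: pure_isometry_cvg0 lV iV adjV pureV h.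
  apply/funext => N; rewrite /Y big_ord_recl w0V (lin0 (orbit_linear _)) add0r.
  rewrite (eq_bigr (fun n : 'I_N => T (orbit n (w n h))
    + A (iter n V (w n h)))) => [|n _]; last by rewrite -orbitS -(wV n).
  rewrite big_split/= -(big_morph T (linD lT) (lin0 lT)) addrC.
  rewrite -(big_morph A (linD lA) (lin0 lA)); congr (A _ + _).
  elim: N => [|N IH]; first by rewrite big_ord0 subrr.
  rewrite big_ord_recr/= IH /w (linB (linear_iter _ lV)) -iterSr.
  by rewrite subrKA.
Qed.

End QuadraticNearness.

(** * The two directions of the similarity criterion *)

Theorem theorem5p4 (R : realType)
  (K H : completeNormedModType R[i])
  (ipK : inner_product K) (ipH : inner_product H)
  (V : H -> H) (Vstar : H -> H) (T : K -> K) (X : H -> K) :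
  pure_isometry V -> is_adjoint ipH V Vstar ->
  right_invertible_contraction T ->
  bounded_op X ->
  similar_to_contraction (Rop T V X) <->
  exists (A : H -> K) (E : K * H -> K * H),
    [/\ bounded_op A, bounded_op2 E /\ nilpotent2 E,
        (forall z, E (Rop T V A z) = (0, 0)),
        (forall z, Rop T V X z = add2 (Rop T V A z) (E z))
      & quad_near (Rop T V A) (Rop T V (fun _ => 0)) (fun h => Vstar h = 0)].
Proof.
move=> [/bounded_op_sqnP[lV _] nV pureV] adj [/bounded_op_sqnP[lT _] nT].
move=> [T' [/bounded_op_sqnP[lT' [cT' cT'0 T'c]] TT']].
move=> /bounded_op_sqnP[lX [cX cX0 Xc]].
have iV h : sqn (V h) = sqn h by rewrite /sqn /rnorm nV.
have T_le k : sqn (T k) <= sqn k.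
  by rewrite /sqn ler_pXn2r ?nnegrE ?rnorm_ge0// -lecR -!rnormE nT.
have Tb k : sqn (T k) <= 1 * sqn k by rewrite mul1r.
have adjV x y : rip ipH (V x) y = rip ipH x (Vstar y) by rewrite /rip adj.
have lVs := adjoint_linear lV adjV.
have VsK := adjoint_isometryK lV iV adjV.
have Vs_le h : sqn (Vstar h) <= sqn h.
  by rewrite -subr_ge0 -(sqn_adjoint_split lV iV adjV) sqn_ge0.
split=> [sim|[A [E [/bounded_op_sqnP[lA [cA cA0 Ac]] _ ERA RXE near]]]].
- have [L [lL [c c0 Lc] XE]] := split_of_similar ipK ipH lT lV lX T_le iV sim.
  pose P h := V (Vstar h).
  have lP : linear P := linear_comp lV lVs.
  have P_le h : sqn (P h) <= sqn h by rewrite iV.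
  (* As [P V = V], this is the corner given by [L P], which vanishes on the kernel of [Vstar]. It
     agrees with [X] on the range of [V], so [E] kills the range of [Rop T V A]. *)
  pose A h := L (V h) - T (L (P h)).
  have lLP := linear_comp lL lP.
  have lA : linear A := linear_sub (linear_comp lL lV) (linear_comp lT lLP).
  have Ac h : sqn (A h) <= 4 * c * sqn h.
    have := sqnB (L (V h)) (T (L (P h))); have := T_le (L (P h)).
    have := Lc (V h); rewrite iV; have := Lc (P h).
    have := ler_wpM2l c0 (P_le h); rewrite -/(A h); lra.
  pose E (z : K * H) : K * H := (X z.2 - A z.2, 0).
  exists A, E; split.
  + by apply/bounded_op_sqnP; split=> //; exists (4 * c) => //; rewrite mulr_ge0.
  + split.
      apply/bounded_op2_sqnP; split=> [s z w|].
        congr pair; rewrite /E/= ?scaler0 ?addr0//.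
        exact: (linear_sub lX lA).
      exists (2 * cX + 2 * (4 * c)) => [|z].
        by rewrite addr_ge0 ?mulr_ge0.
      rewrite /sqn2/= sqn0 addr0; apply: le_trans (sqnB _ _) _.
      apply: (@le_trans _ _ ((2 * cX + 2 * (4 * c)) * sqn z.2)).
        by have := Xc z.2; have := Ac z.2; lra.
      by rewrite ler_wpM2l ?addr_ge0 ?mulr_ge0// lerDr sqn_ge0.
    by exists 2 => z; rewrite /E/= (lin0 lX) (lin0 lA) subrr.
  + by move=> z; rewrite /E /= XE /A /P VsK subrr.
  + move=> z; congr pair; rewrite /= ?addr0//.
    by rewrite -addrA [A _ + _]addrC subrK.
  + apply: (quad_near_of_split lT lV iV adjV (L := fun h => L (P h)) (c := c)) => //.
    * by move=> h; apply: le_trans (Lc _) _; rewrite ler_wpM2l.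
    * by move=> h; rewrite /A /P VsK.
    * by move=> h h0; rewrite /P h0 (lin0 lV) (lin0 lL).
- have [L [lL [c c0 Lc] AE]] := split_of_quad_near lT Tb lV iV adjV lA Ac pureV near.
  have XA h : X (V h) = A (V h).
    (* Compare the two operators at [Rop T V A (0, h)], whose second coordinate is [V h] and where
       [E] vanishes. *)
    have := ERA (0, h); rewrite /Rop/= => E0.
    have := RXE (Rop T V A (0, h)); rewrite ERA /Rop /add2/=.
    by case; rewrite addr0 => /addrI.
  pose D h := X h - A h.
  have lD : linear D := linear_sub lX lA.
  have Dc h : sqn (D h) <= (2 * cX + 2 * cA) * sqn h.
    by have := sqnB (X h) (A h); have := Xc h; have := Ac h; rewrite -/(D h); lra.
  (* The correction [T' D] vanishes on the range of [V], and applying [T] to it restores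
     [D = X - A]. *)
  apply: (@similar_of_split _ _ _ T V X lT T_le iV (fun h => L h - T' (D h))
    (2 * c + 2 * (cT' * (2 * cX + 2 * cA)))).
  + exact: linear_sub lL (linear_comp lT' lD).
  + by rewrite addr_ge0 ?mulr_ge0 ?addr_ge0 ?mulr_ge0.
  + move=> h; have := sqnB (L h) (T' (D h)); have := Lc h; have := T'c (D h).
    by have := ler_wpM2l cT'0 (Dc h); lra.
  + move=> h; rewrite {1}/D XA subrr (lin0 lT') subr0 (linB lT) TT' /D.
    by rewrite opprB addrCA -AE subrK.
Qed.
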